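(* Let $(M,\eta,\xi,g,\Phi)$ be a contact Lorentzian $3$-manifold and let $\alpha:I\to M$ be a non-geodesic Frenet curve with Frenet frame $\{T,N,B\}$. If $\alpha$ is both a magnetic trajectory (of the contact magnetic field of some strength $q\neq0$) and a contact whirl curve, then $\alpha$ is necessarily Legendre. In particular, $\eta(T)=0$ and $\eta(N)=0$ along $\alpha$.
   Context: A contact Lorentzian (contact metric Lorentzian) $3$-manifold $(M,\eta,\xi,g,\Phi)$ is a smooth $3$-manifold with a contact form $\eta$, Reeb vector field $\xi$ ($\eta(\xi)=1$, $d\eta(\xi,\cdot)=0$), a Lorentzian metric $g$ with $g(\xi,\xi)=-1$, and a $(1,1)$-tensor $\Phi$ with $\Phi^2=-\mathrm{id}+\eta\otimes\xi$, $g(\Phi X,\Phi Y)=g(X,Y)+\eta(X)\eta(Y)$ and $d\eta(X,Y)=g(X,\Phi Y)$, where $d\eta(X,Y)=\tfrac12\bigl(X\eta(Y)-Y\eta(X)-\eta([X,Y])\bigr)$. In particular $\eta(X)=-g(X,\xi)$, $\eta\circ\Phi=0$, and, with $\nabla$ the Levi-Civita connection of $g$ and $h=\frac12\mathcal L_\xi\Phi$, one has $\nabla_X\xi=\Phi X-\Phi hX$. A (non-geodesic) Frenet curve is a unit-speed non-null curve $\alpha$, with $T=\alpha'$ and $g(T,T)=\varepsilon_1\in\{\pm1\}$, such that $\nabla_TT$ is non-null. It has an orthonormal Frenet frame $\{T,N,B\}$, with $g(N,N)=\varepsilon_2$, $g(B,B)=\varepsilon_3$, $\varepsilon_1\varepsilon_2=-\varepsilon_3$,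 satisfying $$\nabla_TT=\varepsilon_2\kappa N,\quad \nabla_TN=-\varepsilon_1\kappa T-\varepsilon_3\tau B,\quad \nabla_TB=\varepsilon_2\tau N,$$ with curvature $\kappa>0$ and torsion $\tau$. The curve is Legendre if $\eta(T)=0$ along $\alpha$. It is a contact whirl curve if there is a constant $\varrho\neq0$ with $\eta(T)=\varrho\,\eta(N)$ along $\alpha$. For $q\neq0$, the contact magnetic field of strength $q$ is the closed $2$-form $F_{\xi,q}=-q\,d\eta$. Its Lorentz force, the $(1,1)$-tensor $\varphi$ with $g(\varphi(X),Y)=F_{\xi,q}(X,Y)$, is $\varphi=q\Phi$. A magnetic trajectory is a curve satisfying $\nabla_TT=\varphi(T)$, i.e. $\nabla_TT=q\,\Phi T$. *)

(* Defs.v *)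
From HB Require Import structures.
From mathcomp Require Import all_boot all_order all_algebra.
From mathcomp Require Import all_classical all_reals all_analysis.
From mathcomp Require Import ring lra.

Set Implicit Arguments.
Unset Strict Implicit.
Unset Printing Implicit Defensive.

Import Order.TTheory GRing.Theory Num.Theory.
Import numFieldNormedType.Exports.
Local Open Scope classical_set_scope.
Local Open Scope ring_scope.

(** MathComp-Analysis has no manifolds: a smooth 3-manifold is a Hausdorff
    second countable space with a smooth atlas, and a tensor field is the family
    of its component functions in the charts of the atlas, subject to the usual
    transformation law.  Component functions are defined on all of ['rV[R]_3],
    but only their values on the image of the chart are meaningful. *)

(** [C^oo] on an open set [U]: all iterated directional derivatives are
    differentiable at every point of [U]. *)
Definition smooth_on (R : realType) (V W : normedModType R)
    (U : set V) (f : V -> W) : Prop :=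
  forall (s : seq V) (x : V), U x ->
    differentiable (foldr (fun (v : V) (h : V -> W) => 'D_v h) f s) x.

(** ** Multilinear algebra on [R^3], with vectors as rows *)

Section Algebra.
Context {R : realType}.
Implicit Types (w : 'cV[R]_3) (G P : 'M[R]_3) (u v : 'rV[R]_3).

Definition ev w v : R := (v *m w) 0 0.
Definition scal G u v : R := (u *m G *m v^T) 0 0.

Definition basis_vec (l : 'I_3) : 'rV[R]_3 := delta_mx 0 l.

(** For [G] symmetric and invertible, [raise G f] is the vector [z] such that
    [scal G z v = f v] for all [v], where [f] is a linear form. *)
Definition raise G (f : 'rV[R]_3 -> R) : 'rV[R]_3 :=
  (\row_l f (basis_vec l)) *m invmx G.

(** Symmetric of signature [(-,+,+)]. *)
Definition lorentzian G : Prop :=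
  G^T = G /\
  exists2 P, P \in unitmx &
    P *m G *m P^T = diag_mx (\row_l (if l == ord0 then -1 else 1)).

End Algebra.

(** ** Exterior derivative and Levi-Civita connection in coordinates *)

Section Calculus.
Context {R : realType}.
Implicit Types (w : 'rV[R]_3 -> 'cV[R]_3) (G : 'rV[R]_3 -> 'M[R]_3).
Implicit Types (X Y : 'rV[R]_3 -> 'rV[R]_3) (x u v : 'rV[R]_3).

Definition bracket X Y x : 'rV[R]_3 := 'D_(X x) Y x - 'D_(Y x) X x.

(** The 2-form [dw] on tangent vectors [u], [v] at [x], with the factor [1/2];
    [ext_dE] below is the invariant formula. *)
Definition ext_d w x u v : R :=
  2^-1 * ('D_u (fun y => ev (w y) v) x - 'D_v (fun y => ev (w y) u) x).

(** [(w /\ dw)(u, v, z)], up to a positive normalisation factor. *)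
Definition wedge_d w x u v z : R :=
  ev (w x) u * ext_d w x v z + ev (w x) v * ext_d w x z u
  + ev (w x) z * ext_d w x u v.

(** The vector [u^i v^j Gamma^k_ij], with [Gamma] the Christoffel symbols of
    the Levi-Civita connection of [G]. *)
Definition christoffel G x u v : 'rV[R]_3 :=
  raise (G x) (fun z =>
    2^-1 * ('D_u (fun y => scal (G y) v z) x
            + 'D_v (fun y => scal (G y) u z) x
            - 'D_z (fun y => scal (G y) u v) x)).

(** [nabla_X Y] for vector fields. *)
Definition levi_civita G X Y x : 'rV[R]_3 :=
  'D_(X x) Y x + christoffel G x (X x) (Y x).

End Calculus.

Section Connection.
Context {R : realType}.
Implicit Types (w : 'rV[R]_3 -> 'cV[R]_3) (G : 'rV[R]_3 -> 'M[R]_3).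
Implicit Types (X Y Z : 'rV[R]_3 -> 'rV[R]_3) (x u v : 'rV[R]_3).

Lemma is_derive_mulmx m n p (A : 'rV[R]_3 -> 'M[R]_(m.+1, n.+1))
    (B : 'rV[R]_3 -> 'M[R]_(n.+1, p.+1)) x v :
  derivable A x v -> derivable B x v ->
  is_derive x v (fun y => A y *m B y) ('D_v A x *m B x + A x *m 'D_v B x).
Proof.
move=> dA dB.
have dAB i j : is_derive x v (fun y => (A y *m B y) i j)
    (('D_v A x *m B x + A x *m 'D_v B x) i j).
  have -> : (fun y => (A y *m B y) i j) =
      \sum_k ((fun y => A y i k) * (fun y => B y k j)).
    by apply/funext => y; rewrite mxE fct_sumE.
  have dAi k := (derivable_mxP _ _ _).1 dA i k.
  have dBj k := (derivable_mxP _ _ _).1 dB k j.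
  apply: is_derive_eq.
    apply: is_derive_sum => k; apply: is_deriveM; apply: derivableP.
      exact: dAi.
    exact: dBj.
  rewrite !mxE -big_split; apply: eq_bigr => k _ /=.
  by rewrite !derive_mx // !mxE addrC; congr (_ + _); rewrite mulrC.
have dd : derivable (fun y => A y *m B y) x v.
  by apply/derivable_mxP => i j; case: (dAB i j).
split => //.
by rewrite derive_mx //; apply/matrixP => i j; rewrite mxE; case: (dAB i j).
Qed.

Lemma is_derive_ev w Y x v : derivable w x v -> derivable Y x v ->
  is_derive x v (fun y => ev (w y) (Y y)) (ev (w x) ('D_v Y x) + ev ('D_v w x) (Y x)).
Proof.
move=> dw dY; have [d e] := is_derive_mulmx dY dw.
split; first exact: ((derivable_mxP _ _ _).1 d ord0 ord0).
by have := e; rewrite derive_mx // => /matrixP/(_ 0 0); rewrite !mxE => ->; rewrite /ev !mxE.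
Qed.

Lemma dder (W : normedModType R) (f : 'rV[R]_3 -> W) x u :
  differentiable f x -> derivable f x u.
Proof. exact: diff_derivable. Qed.
Arguments dder {W f x} u _.

Lemma ext_dE w X Y x :
  differentiable w x -> differentiable X x -> differentiable Y x ->
  ext_d w x (X x) (Y x) =
  2^-1 * ('D_(X x) (fun y => ev (w y) (Y y)) x
          - 'D_(Y x) (fun y => ev (w y) (X y)) x - ev (w x) (bracket X Y x)).
Proof.
move=> dw dX dY; rewrite /ext_d /bracket.
have dev Z u : differentiable Z x ->
    'D_u (fun y => ev (w y) (Z y)) x = ev (w x) ('D_u Z x) + ev ('D_u w x) (Z x).
  by move=> dZ; have [] := is_derive_ev (dder u dw) (dder u dZ).
have devc u v : 'D_u (fun y => ev (w y) v) x = ev ('D_u w x) v.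
  by rewrite (dev (cst v)) // derive_cst /ev mul0mx mxE add0r.
rewrite (devc (X x) (Y x)) (devc (Y x) (X x)) (dev Y (X x) dY) (dev X (Y x) dX).
have -> : ev (w x) ('D_(X x) Y x - 'D_(Y x) X x) =
    ev (w x) ('D_(X x) Y x) - ev (w x) ('D_(Y x) X x).
  by rewrite /ev mulmxBl mxE; congr (_ + _); rewrite mxE.
move: (ev _ _) (ev _ _) (ev _ _) (ev _ _) => a b c d; lra.
Qed.

Lemma scalDl A u v z : @scal R A (u + v) z = scal A u z + scal A v z.
Proof. by rewrite /scal !mulmxDl mxE. Qed.
Lemma scalDr A u v z : @scal R A z (u + v) = scal A z u + scal A z v.
Proof. by rewrite /scal linearD mulmxDr mxE. Qed.
Lemma scalZl A a u z : @scal R A (a *: u) z = a * scal A u z.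
Proof. by rewrite /scal -!scalemxAl mxE. Qed.
Lemma scalZr A a u z : @scal R A z (a *: u) = a * scal A z u.
Proof. by rewrite /scal linearZ -scalemxAr mxE. Qed.
Lemma scalC A u v : A^T = A -> @scal R A u v = scal A v u.
Proof.
move=> sA; rewrite /scal.
have -> : u *m A *m v^T = (v *m A *m u^T)^T by rewrite !trmx_mul trmxK sA mulmxA.
by rewrite mxE.
Qed.

Lemma scal_raise A (f : 'rV[R]_3 -> R) v : A^T = A -> A \in unitmx ->
  (forall a u z, f (a *: u + z) = a * f u + f z) -> scal A (raise A f) v = f v.
Proof.
move=> sA uA lf.
have f0 : f 0 = 0 by have := lf (-1) 0 0; rewrite scaler0 add0r mulN1r addNr.
rewrite /scal /raise mulmxKV // [in RHS](row_sum_delta v) mxE.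
have -> : f (\sum_j v 0 j *: delta_mx 0 j) = \sum_j v 0 j * f (delta_mx 0 j).
  elim/big_ind2 : _ => // [a b c d <- <-|i _].
    by rewrite -[X in f (X + _)]scale1r lf mul1r.
  by rewrite -[X in f X]addr0 lf f0 addr0.
by apply: eq_bigr => j _; rewrite !mxE mulrC.
Qed.

Lemma lorentzian_unit A : @lorentzian R A -> A \in unitmx.
Proof.
case=> _ [P uP E].
have : \det (P *m A *m P^T) != 0.
  rewrite E det_diag; apply/prodf_neq0 => i _; rewrite mxE.
  by case: ifP; rewrite ?oppr_eq0 oner_eq0.
by rewrite !det_mulmx !mulf_eq0 !negb_or unitmxE unitfE => /andP[/andP[]].
Qed.

Lemma derive_scal G X Y u x :
  differentiable G x -> differentiable X x -> differentiable Y x ->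
  'D_u (fun y => scal (G y) (X y) (Y y)) x =
  scal ('D_u G x) (X x) (Y x) + scal (G x) ('D_u X x) (Y x)
  + scal (G x) (X x) ('D_u Y x).
Proof.
move=> /(dder u) dG /(dder u) dX /(dder u) dY.
have [d1 e1] := is_derive_mulmx dX dG.
have dYT : derivable (fun y => (Y y)^T) x u.
  apply/derivable_mxP => i j.
  rewrite (_ : (fun _ => _) = (fun y => Y y j i)); last by apply/funext => y; rewrite mxE.
  by have := (derivable_mxP Y x u).1 dY j i.
have eYT : 'D_u (fun y => (Y y)^T) x = ('D_u Y x)^T.
  rewrite (derive_mx dYT) (derive_mx dY); apply/matrixP => i j.
  rewrite [LHS]mxE [RHS]mxE [RHS]mxE.
  have -> // : (fun y => (Y y)^T i j) = (fun y => Y y j i).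
  by apply/funext => y; rewrite mxE.
have [d2 e2] := is_derive_mulmx d1 dYT.
have -> : 'D_u (fun y => scal (G y) (X y) (Y y)) x =
  ('D_u (fun y => X y *m G y *m (Y y)^T) x) 0 0 by rewrite (derive_mx d2) mxE.
rewrite e2 e1 eYT /scal mulmxDl mxE; congr (_ + _).
by rewrite mxE addrC.
Qed.

Lemma derive_scalc G u v z x : differentiable G x ->
  'D_u (fun y => scal (G y) v z) x = scal ('D_u G x) v z.
Proof.
move=> dG; rewrite (@derive_scal G (cst v) (cst z)) // !derive_cst.
rewrite /scal !(mul0mx, trmx0, mulmx0) /=.
by rewrite [(0 : 'M[R]_(1,1)) 0 0]mxE !addr0.
Qed.

Lemma derive_lin (W : normedModType R) (f : 'rV[R]_3 -> W) x a u v :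
  differentiable f x -> 'D_(a *: u + v) f x = a *: 'D_u f x + 'D_v f x.
Proof. by move=> df; rewrite !deriveE // linearD linearZ. Qed.

Lemma scal_lin (A B : 'M[R]_3) a u v :
  scal (a *: A + B) u v = a * scal A u v + scal B u v.
Proof.
rewrite /scal mulmxDr mulmxDl mxE -scalemxAr -scalemxAl.
by congr (_ + _); rewrite mxE.
Qed.

Lemma koszul_raise A (D : 'rV[R]_3 -> 'M[R]_3) u v z :
  A^T = A -> A \in unitmx -> (forall a b c, D (a *: b + c) = a *: D b + D c) ->
  scal A (raise A (fun t => 2^-1 * (scal (D u) v t + scal (D v) u t - scal (D t) u v))) z =
  2^-1 * (scal (D u) v z + scal (D v) u z - scal (D z) u v).
Proof.
move=> sA uA lD; rewrite scal_raise // => a b c.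
rewrite lD scal_lin !scalDr !scalZr; lra.
Qed.

Lemma scal_christoffel G x u v z :
  differentiable G x -> (G x)^T = G x -> G x \in unitmx ->
  scal (G x) (christoffel G x u v) z =
  2^-1 * (scal ('D_u G x) v z + scal ('D_v G x) u z - scal ('D_z G x) u v).
Proof.
move=> dG sG uG.
rewrite /christoffel.
under eq_fun => t do rewrite (derive_scalc u v t dG) (derive_scalc v u t dG) (derive_scalc t u v dG).
exact: (@koszul_raise (G x) (fun t => 'D_t G x) u v z sG uG (fun a b c => derive_lin a b c dG)).
Qed.

Lemma DG_sym G x u : differentiable G x -> (\forall y \near x, (G y)^T = G y) ->
  ('D_u G x)^T = 'D_u G x.
Proof.
move=> dG sG; have dGu := dder u dG.
rewrite derive_mx //; apply/matrixP => i j; rewrite !mxE.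
have [->|u0] := eqVneq u 0; first by rewrite !derive0.
apply: near_eq_derive => //.
by apply: filterS sG => y e; rewrite -[in LHS]e mxE.
Qed.

(** [levi_civita] is torsion-free and compatible with the metric. *)
Lemma levi_civita_torsion G X Y x :
  differentiable G x -> (\forall y \near x, (G y)^T = G y) -> G x \in unitmx ->
  levi_civita G X Y x - levi_civita G Y X x = bracket X Y x.
Proof.
move=> dG sG uG; rewrite /levi_civita /bracket.
rewrite (_ : christoffel G x (X x) (Y x) =
  christoffel G x (Y x) (X x)); first by rewrite opprD addrACA subrr addr0.
rewrite /christoffel; congr raise; apply/funext => z.
rewrite (derive_scalc z (X x) (Y x) dG) (derive_scalc z (Y x) (X x) dG).
rewrite (scalC (X x) (Y x) (DG_sym z dG sG)).
by congr (_ * (_ - _)); rewrite addrC.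
Qed.

Lemma metric_alg A (D : 'rV[R]_3 -> 'M[R]_3) (C : 'rV[R]_3 -> 'rV[R]_3 -> 'rV[R]_3) u y z dy dz :
  A^T = A -> (forall t, (D t)^T = D t) ->
  (forall u v z, scal A (C u v) z = 2^-1 * (scal (D u) v z + scal (D v) u z - scal (D z) u v)) ->
  scal (D u) y z + scal A dy z + scal A y dz =
  scal A (dy + C u y) z + scal A y (dz + C u z).
Proof.
move=> sA sD cE; rewrite scalDl scalDr (scalC y (C u z) sA) !cE.
rewrite (scalC z y (sD u)); lra.
Qed.

Lemma levi_civita_metric G X Y Z x :
  differentiable G x -> differentiable Y x -> differentiable Z x ->
  (\forall y \near x, (G y)^T = G y) -> G x \in unitmx ->
  'D_(X x) (fun y => scal (G y) (Y y) (Z y)) x =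
  scal (G x) (levi_civita G X Y x) (Z x) + scal (G x) (Y x) (levi_civita G X Z x).
Proof.
move=> dG dY dZ sG uG; have sGx := nbhs_singleton sG.
rewrite (derive_scal (X x) dG dY dZ) /levi_civita.
exact: (@metric_alg (G x) (fun t => 'D_t G x) (christoffel G x) _ _ _ _ _ sGx
  (fun t => DG_sym t dG sG) (fun u v z => scal_christoffel u v z dG sGx uG)).
Qed.
End Connection.

(** ** Manifolds and tensor fields *)

Record chart (R : realType) (M : topologicalType) := Chart {
  chart_dom : set M;
  chart_im : set 'rV[R]_3;
  chart_coord : M -> 'rV[R]_3;
  chart_inv : 'rV[R]_3 -> M;
  chart_dom_open : open chart_dom;
  chart_im_open : open chart_im;
  chart_coord_im : forall p, chart_dom p -> chart_im (chart_coord p);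
  chart_inv_dom : forall x, chart_im x -> chart_dom (chart_inv x);
  chart_coordK : forall p, chart_dom p -> chart_inv (chart_coord p) = p;
  chart_invK : forall x, chart_im x -> chart_coord (chart_inv x) = x;
  chart_coord_continuous : {within chart_dom, continuous chart_coord};
  chart_inv_continuous : {within chart_im, continuous chart_inv}
}.

Definition overlap (R : realType) (M : topologicalType) (c d : chart R M) :
  set 'rV[R]_3 := [set x | chart_im c x /\ chart_dom d (chart_inv c x)].

Definition transition (R : realType) (M : topologicalType) (c d : chart R M) :
  'rV[R]_3 -> 'rV[R]_3 := fun x => chart_coord d (chart_inv c x).

Record manifold3 (R : realType) := Manifold3 {
  space :> topologicalType;
  space_hausdorff : hausdorff_space space;
  space_second_countable : @second_countable space;
  chart_index : Type;
  atlas : chart_index -> chart R space;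
  atlas_cover : forall p : space, exists i, chart_dom (atlas i) p;
  atlas_smooth : forall i j,
    smooth_on (overlap (atlas i) (atlas j)) (transition (atlas i) (atlas j))
}.

Section Tensors.
Context {R : realType} (M : manifold3 R).
Local Notation ch := (@atlas R M).

(** Pushforward of tangent vectors at [x] by a change of charts. *)
Definition push (i j : chart_index M) (x v : 'rV[R]_3) : 'rV[R]_3 :=
  'd (transition (ch i) (ch j)) x v.

Local Notation on_overlaps P :=
  (forall i j x, overlap (ch i) (ch j) x ->
     P i j x (transition (ch i) (ch j) x)) (only parsing).

Definition vector_field (X : chart_index M -> 'rV[R]_3 -> 'rV[R]_3) : Prop :=
  (forall i, smooth_on (chart_im (ch i)) (X i)) /\
  on_overlaps (fun i j x y => X j y = push i j x (X i x)).

Definition one_form (w : chart_index M -> 'rV[R]_3 -> 'cV[R]_3) : Prop :=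
  (forall i, smooth_on (chart_im (ch i)) (w i)) /\
  on_overlaps (fun i j x y =>
    forall v, ev (w j y) (push i j x v) = ev (w i x) v).

Definition endo_field (F : chart_index M -> 'rV[R]_3 -> 'M[R]_3) : Prop :=
  (forall i, smooth_on (chart_im (ch i)) (F i)) /\
  on_overlaps (fun i j x y =>
    forall v, push i j x v *m F j y = push i j x (v *m F i x)).

Definition lorentz_metric (G : chart_index M -> 'rV[R]_3 -> 'M[R]_3) : Prop :=
  [/\ forall i, smooth_on (chart_im (ch i)) (G i),
      on_overlaps (fun i j x y => forall u v,
        scal (G j y) (push i j x u) (push i j x v) = scal (G i x) u v)
    & forall i x, chart_im (ch i) x -> lorentzian (G i x)].

(** [w /\ dw] vanishes nowhere. *)
Definition contact_form (w : chart_index M -> 'rV[R]_3 -> 'cV[R]_3) : Prop :=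
  one_form w /\
  forall i x, chart_im (ch i) x ->
    wedge_d (w i) x (basis_vec 0) (basis_vec 1) (basis_vec 2) != 0.

End Tensors.

Record contact_lorentzian3 (R : realType) := ContactLorentzian3 {
  mfd :> manifold3 R;
  eta : chart_index mfd -> 'rV[R]_3 -> 'cV[R]_3;
  xi : chart_index mfd -> 'rV[R]_3 -> 'rV[R]_3;
  met : chart_index mfd -> 'rV[R]_3 -> 'M[R]_3;
  Phi : chart_index mfd -> 'rV[R]_3 -> 'M[R]_3;
  eta_contact : contact_form eta;
  xi_field : vector_field xi;
  met_lorentz : lorentz_metric met;
  Phi_field : endo_field Phi;
  reeb_eta : forall i x, chart_im (atlas i) x -> ev (eta i x) (xi i x) = 1;
  reeb_d : forall i x v, chart_im (atlas i) x -> ext_d (eta i) x (xi i x) v = 0;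
  met_xi : forall i x, chart_im (atlas i) x ->
    scal (met i x) (xi i x) (xi i x) = -1;
  Phi_sqr : forall i x v, chart_im (atlas i) x ->
    v *m Phi i x *m Phi i x = - v + ev (eta i x) v *: xi i x;
  met_Phi : forall i x u v, chart_im (atlas i) x ->
    scal (met i x) (u *m Phi i x) (v *m Phi i x) =
    scal (met i x) u v + ev (eta i x) u * ev (eta i x) v;
  d_eta_Phi : forall i x u v, chart_im (atlas i) x ->
    ext_d (eta i) x u v = scal (met i x) u (v *m Phi i x)
}.

(** ** The contact magnetic field *)

Section Magnetic.
Context {R : realType} (M : contact_lorentzian3 R).

Definition magnetic_field (q : R) (i : chart_index M) (x u v : 'rV[R]_3) : R :=
  - q * ext_d (eta i) x u v.

(** The Lorentz force [phi], [g(phi u, v) = F(u, v)]. *)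
Definition lorentz_force (q : R) (i : chart_index M) (x u : 'rV[R]_3) : 'rV[R]_3 :=
  raise (met i x) (magnetic_field q i x u).

End Magnetic.

(** ** Curves *)

Section Curves.
Context {R : realType} (M : contact_lorentzian3 R).
Variables (I : set R) (alpha : R -> M).

Definition in_chart (i : chart_index M) : set R :=
  [set t | I t /\ chart_dom (atlas i) (alpha t)].

Definition local_curve (i : chart_index M) (t : R) : 'rV[R]_3 :=
  chart_coord (atlas i) (alpha t).

Definition smooth_curve : Prop :=
  {within I, continuous alpha} /\
  forall i, smooth_on (in_chart i) (local_curve i).

(** Vector fields along [alpha], by their components in the charts. *)
Definition field_along (V : chart_index M -> R -> 'rV[R]_3) : Prop :=
  (forall i, smooth_on (in_chart i) (V i)) /\
  forall i j t, in_chart i t -> in_chart j t ->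
    V j t = push i j (local_curve i t) (V i t).

Definition velocity (i : chart_index M) : R -> 'rV[R]_3 := derive1 (local_curve i).

Definition cov_deriv (V : chart_index M -> R -> 'rV[R]_3) (i : chart_index M) (t : R) :
    'rV[R]_3 :=
  derive1 (V i) t + christoffel (met i) (local_curve i t) (velocity i t) (V i t).

Definition g_along (U V : chart_index M -> R -> 'rV[R]_3) (i : chart_index M) (t : R) : R :=
  scal (met i (local_curve i t)) (U i t) (V i t).

Definition eta_along (V : chart_index M -> R -> 'rV[R]_3) (i : chart_index M) (t : R) : R :=
  ev (eta i (local_curve i t)) (V i t).

Local Notation T := velocity.

(** Non-geodesic Frenet curve with frame [(velocity, N, B)], causal
    characters [e1], [e2], [e3], curvature [kappa] and torsion [tau]. *)
Record frenet_curve (N B : chart_index M -> R -> 'rV[R]_3) (kappa tau : R -> R)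
    (e1 e2 e3 : R) : Prop := FrenetCurve {
  frenet_interval : is_interval I /\ open I;
  frenet_smooth : smooth_curve;
  frenet_N : field_along N;
  frenet_B : field_along B;
  frenet_e1 : e1 = 1 \/ e1 = -1;
  frenet_e2 : e2 = 1 \/ e2 = -1;
  frenet_e3 : e3 = 1 \/ e3 = -1;
  frenet_e : e1 * e2 = - e3;
  frenet_norm : forall i t, in_chart i t ->
    [/\ g_along T T i t = e1, g_along N N i t = e2 & g_along B B i t = e3];
  frenet_orth : forall i t, in_chart i t ->
    [/\ g_along T N i t = 0, g_along T B i t = 0 & g_along N B i t = 0];
  frenet_nonnull : forall i t, in_chart i t ->
    g_along (cov_deriv T) (cov_deriv T) i t != 0;
  frenet_kappa : forall t, I t -> 0 < kappa t;
  frenet_dT : forall i t, in_chart i t ->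
    cov_deriv T i t = (e2 * kappa t) *: N i t;
  frenet_dN : forall i t, in_chart i t ->
    cov_deriv N i t = - (e1 * kappa t) *: T i t - (e3 * tau t) *: B i t;
  frenet_dB : forall i t, in_chart i t ->
    cov_deriv B i t = (e2 * tau t) *: N i t
}.

Definition legendre : Prop :=
  forall i t, in_chart i t -> eta_along T i t = 0.

Definition contact_whirl (N : chart_index M -> R -> 'rV[R]_3) : Prop :=
  exists2 rho : R, rho != 0 &
    forall i t, in_chart i t -> eta_along T i t = rho * eta_along N i t.

Definition magnetic_trajectory (q : R) : Prop :=
  forall i t, in_chart i t ->
    cov_deriv T i t = lorentz_force q i (local_curve i t) (T i t).

End Curves.

(* Main.v *)
Require Import Defs.
From mathcomp Require Import all_boot all_order all_algebra.
From mathcomp Require Import all_classical all_reals all_analysis.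

Import Order.TTheory GRing.Theory Num.Theory.
Import numFieldNormedType.Exports.
Local Open Scope classical_set_scope.
Local Open Scope ring_scope.

(** The statement is pointwise.  The Lorentz force of the contact magnetic field
    takes its values in the contact distribution: [eta] is the metric dual of
    [- xi], so that [eta (phi u) = - F (u, xi) = q * d eta (u, xi)], and this
    vanishes by the Reeb condition ([eta_lorentz_force]).  Along a magnetic
    Frenet curve the force on [T] is [nabla_T T = e2 kappa N] with
    [e2 kappa != 0], whence [eta N = 0]: the principal normal of every magnetic
    trajectory lies in the contact distribution.  The whirl condition
    [eta T = rho * eta N] then gives [eta T = 0]. *)

Section LorentzForce.
Context {R : realType} (M : contact_lorentzian3 R).
Implicit Types (i : chart_index M) (x u v : 'rV[R]_3).

Lemma evZ (w : 'cV[R]_3) (a : R) v : ev w (a *: v) = a * ev w v.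
Proof. by rewrite /ev -scalemxAl mxE. Qed.

Lemma ext_dC (w : 'rV[R]_3 -> 'cV[R]_3) x u v : ext_d w x v u = - ext_d w x u v.
Proof. by rewrite /ext_d -mulrN opprB. Qed.

(** The Reeb condition says that [xi] is orthogonal to the image of [Phi], in
    particular to [Phi (Phi u) = - u + eta u *: xi]; with [g (xi, xi) = -1] this
    orthogonality relation reads [g (xi, u) = - eta u]. *)
Lemma eta_dual i x u : chart_im (atlas i) x ->
  ev (eta i x) u = - scal (met i x) (xi i x) u.
Proof.
move=> Ux; have := d_eta_Phi (xi i x) (u *m Phi i x) Ux.
rewrite reeb_d // Phi_sqr // -scaleN1r scalDr !scalZr met_xi // mulN1r mulrN1.
by move=> /esym /eqP; rewrite subr_eq0 => /eqP <-.
Qed.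

(** Linearity of [F] in its second slot, which representing it through the
    metric requires, comes from [d eta = g (-, Phi -)] rather than from the
    coordinate formula for [d eta]. *)
Lemma scal_lorentz_force (q : R) i x u v : chart_im (atlas i) x ->
  scal (met i x) (lorentz_force q i x u) v = magnetic_field q i x u v.
Proof.
move=> Ux; have [_ _ /(_ i x Ux) lG] := met_lorentz M.
apply: scal_raise => [||a y z]; [by case: lG | exact: lorentzian_unit lG |].
rewrite /magnetic_field !d_eta_Phi // mulmxDl -scalemxAl scalDr scalZr.
by rewrite mulrDr mulrCA.
Qed.

Lemma eta_lorentz_force (q : R) i x u : chart_im (atlas i) x ->
  ev (eta i x) (lorentz_force q i x u) = 0.
Proof.
move=> Ux; have [_ _ /(_ i x Ux) [sG _]] := met_lorentz M.
rewrite eta_dual // scalC // scal_lorentz_force // /magnetic_field.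
by rewrite ext_dC reeb_d // oppr0 mulr0 oppr0.
Qed.

End LorentzForce.

(** The acceleration [e2 * kappa *: N] is a Lorentz force, hence is killed by
    [eta], and its coefficient does not vanish. *)
Lemma magnetic_eta_normal (R : realType) (M : contact_lorentzian3 R)
    (I : set R) (alpha : R -> M) (N B : chart_index M -> R -> 'rV[R]_3)
    (kappa tau : R -> R) (e1 e2 e3 q : R) (i : chart_index M) (t : R) :
  frenet_curve I alpha N B kappa tau e1 e2 e3 ->
  magnetic_trajectory I alpha q ->
  in_chart I alpha i t -> eta_along alpha N i t = 0.
Proof.
move=> fr mag it; have [It dom_t] := it.
have /eqP := eta_lorentz_force M q i _ (velocity alpha i t) (chart_coord_im dom_t).
rewrite -(mag i t it) (frenet_dT fr it) evZ !mulf_eq0.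
have -> : (e2 == 0) = false.
  by case: (frenet_e2 fr) => ->; rewrite ?oppr_eq0 oner_eq0.
by rewrite (gt_eqF (frenet_kappa fr It)) => /eqP.
Qed.

Theorem proposition3p9 (R : realType) (M : contact_lorentzian3 R)
    (I : set R) (alpha : R -> M) (N B : chart_index M -> R -> 'rV[R]_3)
    (kappa tau : R -> R) (e1 e2 e3 : R)
    (Halpha : frenet_curve I alpha N B kappa tau e1 e2 e3)
    (Hmagnetic : exists2 q : R, q != 0 & magnetic_trajectory I alpha q)
    (Hwhirl : contact_whirl I alpha N) :
  legendre I alpha /\
  (forall (i : chart_index M) (t : R), in_chart I alpha i t ->
     eta_along alpha (velocity alpha) i t = 0 /\ eta_along alpha N i t = 0).
Proof.
have [q _ mag] := Hmagnetic; have [rho _ whirl] := Hwhirl.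
have etaN i t : in_chart I alpha i t -> eta_along alpha N i t = 0.
  by move=> it; exact: magnetic_eta_normal Halpha mag it.
have etaT : legendre I alpha by move=> i t it; rewrite whirl // etaN // mulr0.
by split=> // i t it; split; [exact: etaT | exact: etaN].
Qed.
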